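(* Let $b\in\mathbb{N}_0$ and $v\in(0,1]$; assume $E[C_1]<\infty$ and that not both $p_0+p_1=1$ and $v=1$. For $x\in\mathbb{Z}$, the quantity $V_B^b(x):=E_x^{b]}\big[v^{\tilde\tau_{-1}^-}(-\tilde X(\tilde\tau_{-1}^-));\tilde\tau_{-1}^-<\infty\big]$ is given by $$V_B^b(x)=\begin{cases}W_v(x)\,\dfrac{\Delta Z_{1,v}(b)}{\Delta W_v(b)}-Z_{1,v}(x), & x\le b,\\[2mm] V_B^b(b), & x>b.\end{cases}$$
   Context: Notation: $\mathbb{N}=\{1,2,\dots\}$, $\mathbb{N}_0=\{0,1,2,\dots\}$; $E[Y;A]:=E[Y\mathbf{1}_A]$; $\inf\emptyset=\infty$; $\Delta f(k):=f(k+1)-f(k)$ for $k\in\mathbb{N}_0$. Let $(p_k)_{k\in\mathbb{N}_0}$ be a probability mass function on $\mathbb{N}_0$ with $p_0>0$, and let $C_1,C_2,\dots$ be i.i.d. with $P(C_1=k)=p_k$. Let $X_n=X_0+n-\sum_{i=1}^nC_i$, $n\in\mathbb{N}_0$; for $x\in\mathbb{Z}$, $P_x$ (expectation $E_x$) is the law under which $X_0=x$, and $P=P_0$, $E=E_0$. For $b\in\mathbb{Z}$ let $\tau_b^-=\inf\{n\in\mathbb{N}_0:X_n\le b\}$ and $\tau_b^+=\inf\{n\in\mathbb{N}_0:X_n\ge b\}$. For $v\in(0,1]$: $W_v(y):=\big(p_0E[v^{\tau_y^+};\tau_y^+<\tau_{-1}^-]\big)^{-1}$ for $y\in\mathbb{N}_0$,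 and $W_v(y):=0$ for integers $y<0$. For $v,w\in(0,1]$ and $x\in\mathbb{Z}$: $\Psi_v(x,w):=E_x[v^{\tau_{-1}^-}w^{-X(\tau_{-1}^-)};\tau_{-1}^-<\infty]$ and $Z_v(x,w):=\Psi_v(x,w)+\alpha_v(w)W_v(x)$, where the constant $\alpha_v(w)\in[0,\infty)$ is chosen so that $Z_v(0,w)=1$. When $E[C_1]<\infty$, $Z_{1,v}(x):=-\frac{\partial Z_v(x,w)}{\partial w}\big|_{w=1-}$ (left derivative at $w=1$). Process reflected at $b\in\mathbb{N}_0$ (barrier dividend policy $\pi_b$): with initial capital $x\in\mathbb{Z}$, the dividend $r(0)=\max(x-b,0)$ is paid and $\tilde X_0=x-r(0)$; for $k\in\mathbb{N}$, as long as ruin has not yet occurred, $r(k)=\max(\tilde X_{k-1}+1-C_k-b,0)$ and $\tilde X_k=\tilde X_{k-1}+1-C_k-r(k)$. The ruin time is $\tilde\tau_{-1}^-:=\inf\{k\in\mathbb{N}_0:\tilde X_k<0\}$, after which the process is stopped. $P_x^{b]},E_x^{b]}$ denote probability and expectation for this process with initial capital $x$. *)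

(* Defs.v *)
From HB Require Import structures.
From mathcomp Require Import all_boot all_order all_algebra.
From mathcomp Require Import all_classical all_reals all_analysis.
Set Implicit Arguments.
Unset Strict Implicit.
Unset Printing Implicit Defensive.
Import Order.TTheory GRing.Theory Num.Theory.
Import numFieldNormedType.Exports.
Local Open Scope classical_set_scope.
Local Open Scope ring_scope.

Definition is_pmf (R : realType) (p : nat -> R) : Prop :=
  (forall k, 0 <= p k) /\ (\sum_(0 <= k <oo) (p k)%:E = 1)%E.

Definition mutually_independent (R : realType) (d d' : measure_display)
    (T : measurableType d) (T' : measurableType d') (P : probability T R)
    (C : nat -> {RV P >-> T'}) : Prop :=
  forall (J : seq nat) (A : nat -> set T'),
    uniq J -> (forall j, measurable (A j)) ->
    (P (\bigcap_(j in [set` J]) (C j @^-1` A j))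
     = \prod_(j <- J) P (C j @^-1` A j))%E.

(* [C i] stands for the claim $C_{i+1}$: the sequence starts at index 0. *)
Definition iid_with_pmf (R : realType) (d : measure_display)
    (T : measurableType d) (P : probability T R) (C : nat -> {RV P >-> nat})
    (p : nat -> R) : Prop :=
  mutually_independent C /\
  forall i k, P (C i @^-1` [set k]) = (p k)%:E.

(* $\inf\{n : Q(n)\}$ in $\mathbb{N}_0\cup\{\infty\}$; [None] is $\infty$. *)
Definition first_time (Q : pred nat) : option nat :=
  if pselect (exists n, Q n) is left e then Some (ex_minn e) else None.

Definition time_lt (s t : option nat) : bool :=
  match s, t with
  | Some m, Some n => (m < n)%N
  | Some _, None => true
  | None, _ => false
  end.

Definition hit_below (X : nat -> int) (b : int) : option nat :=
  first_time (fun n => X n <= b).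

Definition hit_above (X : nat -> int) (b : int) : option nat :=
  first_time (fun n => b <= X n).

(* Paths driven by a realisation [c] of the claims.  The law $P_x$ is rendered
   by starting the path at [x] under the fixed probability carrying the
   claims. *)
Definition walk (c : nat -> nat) (x : int) (n : nat) : int :=
  x + n%:Z - \sum_(i < n) (c i)%:Z.

Definition dividend (b : nat) (y : int) : int := Num.max (y - b%:Z) 0.

Fixpoint reflected (c : nat -> nat) (b : nat) (x : int) (k : nat) : int :=
  if k is k'.+1 then
    let y := reflected c b x k' in
    if y < 0 then y
    else let z := y + 1 - (c k')%:Z in z - dividend b z
  else x - dividend b x.

Definition ruin_time (X : nat -> int) : option nat :=
  first_time (fun k => X k < 0).

Definition left_derivative (R : realType) (f : R -> R) (a : R) : R :=
  lim (h^-1 * (f (a + h) - f a) @[h --> 0^'-]).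

Definition fdiff (R : realType) (f : int -> R) (k : nat) : R :=
  f k.+1%:Z - f k%:Z.

Section scale_functions.
Context (R : realType) (d : measure_display) (T : measurableType d).
Context (P : probability T R) (C : nat -> {RV P >-> nat}) (p : nat -> R).

Definition W (v : R) (y : int) : R :=
  if y < 0 then 0
  else (p 0%N * fine 'E_P[fun t =>
          let X := walk (C ^~ t) 0 in
          if hit_above X y is Some n then
            if time_lt (Some n) (hit_below X (-1)) then v ^+ n else 0
          else 0])^-1.

Definition Psi (v : R) (x : int) (w : R) : R :=
  fine 'E_P[fun t =>
    let X := walk (C ^~ t) x in
    if hit_below X (-1) is Some n then v ^+ n * w ^ (- X n) else 0].

(* The unique constant such that $Z_v(0,w)=1$; see [Z_at0] and [alpha_ge0]. *)
Definition alpha (v w : R) : R := (1 - Psi v 0 w) / W v 0.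

Definition Z (v : R) (x : int) (w : R) : R :=
  Psi v x w + alpha v w * W v x.

Definition Z1 (v : R) (x : int) : R := - left_derivative (Z v x) 1.

Definition VB (b : nat) (v : R) (x : int) : \bar R :=
  'E_P[fun t =>
    let X := reflected (C ^~ t) b x in
    if ruin_time X is Some n then v ^+ n * (- X n)%:~R else 0].

Lemma W_at0 (v : R) : W v 0 = (p 0%N)^-1.
Proof.
rewrite /W ltxx; congr (_^-1).
suff -> : (fun t => let X := walk (C ^~ t) 0 in
   if hit_above X 0 is Some n then
     if time_lt (Some n) (hit_below X (-1)) then v ^+ n else 0
   else 0) = cst 1 by rewrite expectation_cst /= mulr1.
apply/funext => t /=.
have X0 : walk (C ^~ t) 0 0 = 0 by rewrite /walk big_ord0.
have -> : hit_above (walk (C ^~ t) 0) 0 = Some 0%N.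
  rewrite /hit_above /first_time; case: pselect => [e|[]]; last first.
    by exists 0%N; rewrite X0.
  case: ex_minnP => m _ /(_ 0%N); rewrite X0 lexx leqn0 => /(_ isT)/eqP -> //.
rewrite /hit_below /first_time; case: pselect => [e|//] /=.
case: ex_minnP => -[|m] //; by rewrite X0.
Qed.

Lemma Z_at0 (v w : R) : 0 < p 0%N -> Z v 0 w = 1.
Proof.
move=> p0; rewrite /Z /alpha W_at0 divfK ?invr_neq0 ?gt_eqF//.
by rewrite addrC subrK.
Qed.

Lemma alpha_ge0 (v w : R) :
  0 < p 0%N -> 0 < v <= 1 -> 0 < w <= 1 -> 0 <= alpha v w.
Proof.
move=> p0 /andP[v0 v1] /andP[w0 w1].
rewrite /alpha W_at0 invrK mulr_ge0 ?(ltW p0)// subr_ge0 /Psi.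
set f := (X in expectation P X).
have f01 t : 0 <= f t <= 1.
  rewrite /f /=; case E : (hit_below _ _) => [n|]; last by rewrite lexx ler01.
  have : walk (C ^~ t) 0 n <= -1.
    move: E; rewrite /hit_below /first_time; case: pselect => // e [<-].
    by case: ex_minnP.
  rewrite lerNr => /(le_trans ler01) /gez0_abs <-; rewrite -exprnP.
  have [v0' w0'] := (ltW v0, ltW w0).
  by rewrite mulr_ge0 ?exprn_ge0//= mulr_ile1 ?exprn_ge0 ?exprn_ile1.
have : (0 <= 'E_P[f] <= 1)%E.
  rewrite unlock; apply/andP; split.
    by apply: integral_ge0 => t _; rewrite lee_fin; case/andP: (f01 t).
  rewrite ge0_integralTE; last first.
    by move=> t; rewrite lee_fin; case/andP: (f01 t).
  have -> : 1%E = (\int[P]_t (cst 1%E t))%E :> \bar R.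
    by rewrite integral_cst//= mul1e; apply/esym/probability_setT.
  rewrite ge0_integralTE; last by move=> t; rewrite lee_fin.
  apply: ereal_sup_le => _ [h hf <-]; exists h => // t.
  by apply: le_trans (hf t) _; rewrite lee_fin; case/andP: (f01 t).
by case: ('E_P[f])%E => [r| |] //=; rewrite !lee_fin => /andP[].
Qed.

End scale_functions.

(* Main.v *)
Require Import Defs.
From HB Require Import structures.
From mathcomp Require Import all_boot all_order all_algebra.
From mathcomp Require Import all_classical all_reals all_analysis.
From mathcomp Require Import measurable_realfun.
From mathcomp Require Import zify ring lra.
Import Order.TTheory GRing.Theory Num.Theory.
Import numFieldNormedType.Exports.
Local Open Scope classical_set_scope.
Local Open Scope ring_scope.

(** Write [Delta f b = f (b + 1) - f b].  The function [1 / W], the transform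
    [Psi] and the expected discounted deficit [VB] are all expectations of one
    kind of functional: a chain driven by the claims runs until it enters a
    stopping set, and [v ^+ N * g y] is collected if this happens at time [N]
    in the state [y] ([chain_value]).  Conditioning on the first claim
    ([value_first_step]) turns each of them into a linear recursion, and these
    recursions are all that is needed of the paths.

    The surplus climbs by at most one per period.  So, with
    [conv p f x] the sum of [p k * f (x + 1 - k)] over [k <= x + 1] and
    [tail C g x] the expectation of [g (C 0 - x - 1)] over [C 0 > x + 1], for
    all [x >= 0]

    - [W x = v * conv W x] ([W_harmonic]);
    - [Z x w = v * (conv (Z _ w) x + tail (w ^+ _) x)] ([Z_rec]), whence by
      differentiation [Z1 x = v * (conv Z1 x - tail id x)] ([Z1_rec]);
    - [VB x = v * (conv (fun n => VB (min n b)) x + tail id x)] for [x <= b]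
      ([ruin_cost_reflected]).

    For every constant [c] the function [H = c * W - Z1] thus solves the
    recursion of [VB] except that it has no reflection.  Taking
    [c = Delta Z1 b / Delta W b] makes [H (b + 1) = H b], which is exactly
    what reflection at [b] requires, so this [H] solves the recursion of [VB]
    ([candidate_reflected]).

    It remains to see that the recursion of [VB] has one solution only.  This
    is a minimum principle on [0 .. b] ([minimum_principle]): in every state
    either mass is lost, by discounting or by ruin, or a claim of at least two
    moves the surplus strictly down ([loss_or_descent]), and both are
    incompatible with a negative minimum; in the excluded case
    [p 0 + p 1 = 1], [v = 1] neither happens.  The principle is used twice.
    It gives [H >= 0], so that [H] is a finite superharmonic majorant and
    [VB <= H < oo]; then it applies to [H - VB] and to [VB - H].  The same
    alternative yields [Delta W b > 0] ([W_increasing]).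

    The derivative [Z1] has to be obtained from the recursion of [Z] and not
    term by term from [Psi] and [alpha]: a finite mean of the claims does not
    make the mean deficit of the free walk finite (it is infinite when [v = 1],
    the mean claim is below one and the second moment is infinite), and then
    [Psi] has no finite left derivative at 1.  In the recursion for [Z] only
    [tail (w ^+ _) x] has to be differentiated, and there the mean claim is a
    sufficient dominating function ([cvg_slope_tail]). *)

(** * First times and payoffs of driven paths *)

Section first_time.
Set Implicit Arguments.
Unset Strict Implicit.
Implicit Type Q : pred nat.

Lemma first_time_some Q n :
  first_time Q = Some n <-> Q n /\ forall m, (m < n)%N -> ~~ Q m.
Proof.
rewrite /first_time; case: pselect => [e|nQ]; last first.
  by split=> // -[Qn _]; case: nQ; exists n.
case: ex_minnP => k Qk kmin; split=> [[<-]|[Qn nmin]].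
  by split=> // m; apply: contraTN => /kmin; rewrite -leqNgt.
congr Some; apply/eqP; rewrite eqn_leq kmin//= leqNgt.
by apply: contraTN Qk; exact: nmin.
Qed.

Lemma first_time_none Q : first_time Q = None <-> forall n, ~~ Q n.
Proof.
rewrite /first_time; case: pselect => [e|nQ]; split=> //.
- by case: e => n Qn /(_ n); rewrite Qn.
- by move=> _ n; apply/negP => Qn; apply: nQ; exists n.
Qed.

Lemma eq_first_time Q Q' : Q =1 Q' -> first_time Q = first_time Q'.
Proof. by move=> /funext ->. Qed.

Lemma first_time0 Q : Q 0%N -> first_time Q = Some 0%N.
Proof. by move=> Q0; apply/first_time_some. Qed.

Lemma first_timeS Q : ~~ Q 0%N ->
  first_time Q = omap succn (first_time (fun n => Q n.+1)).
Proof.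
move=> Q0; case E : (first_time (fun n => Q n.+1)) => [n|] /=.
  move/first_time_some: E => [Qn nmin]; apply/first_time_some.
  by split=> // -[|m]//; exact: nmin.
by move/first_time_none: E => nQ; apply/first_time_none => -[|n].
Qed.

End first_time.

Section payoff.
Set Implicit Arguments.
Unset Strict Implicit.
Context {R : realType}.
Variables (next : int -> nat -> int) (stop : pred int) (g : int -> R) (v : R).

Fixpoint run (c : nat -> nat) (x : int) (n : nat) : int :=
  if n is n'.+1 then next (run c x n') (c n') else x.

(** The reward discounted to the first visit of the stopping set, and 0 on
    paths that never visit it. *)
Definition payoff (X : nat -> int) : R :=
  if first_time (stop \o X) is Some n then v ^+ n * g (X n) else 0.

(** The payoff restricted to stopping times at most [n].  It depends on finitely
    many claims only, so its law can be computed by induction, and it is written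
    as a recursion on the first claim because that is the induction. *)
Fixpoint truncated_payoff (n : nat) (c : nat -> nat) (x : int) : R :=
  if stop x then g x
  else if n is n'.+1 then
    v * truncated_payoff n' (fun i => c i.+1) (next x (c 0%N))
  else 0.

Lemma run_shift c x n :
  run c x n.+1 = run (fun i => c i.+1) (next x (c 0%N)) n.
Proof. by elim: n => //= n <-. Qed.

Lemma payoff_stop X : stop (X 0%N) -> payoff X = g (X 0%N).
Proof. by move=> sX; rewrite /payoff first_time0//= mul1r. Qed.

Lemma truncated_payoffE n c x : truncated_payoff n c x =
  if first_time (stop \o run c x) is Some m
  then if (m <= n)%N then v ^+ m * g (run c x m) else 0 else 0.
Proof.
elim: n c x => [|n IHn] c x /=; case: ifPn => sx.
- by rewrite first_time0//= mul1r.
- by rewrite first_timeS//; case: first_time.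
- by rewrite first_time0//= mul1r.
- rewrite IHn; have -> : first_time (stop \o run c x) = omap succn
      (first_time (stop \o run (fun i => c i.+1) (next x (c 0%N)))).
    rewrite first_timeS//; congr omap; apply: eq_first_time => m.
    by rewrite /comp run_shift.
  case: (first_time _) => [m|]; rewrite ?mulr0//= ltnS.
  by case: ifP => _; rewrite ?mulr0// exprS -mulrA -run_shift.
Qed.

Hypotheses (v0 : 0 <= v) (g0 : forall x, stop x -> 0 <= g x).

Lemma truncated_payoff_ge0 n c x : 0 <= truncated_payoff n c x.
Proof.
by elim: n c x => [|n IHn] c x /=; case: ifPn => [/g0//|_]; rewrite ?mulr_ge0.
Qed.

Lemma truncated_payoff_homo c x :
  {homo (fun n => truncated_payoff n c x) : m n / (m <= n)%N >-> m <= n}.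
Proof.
apply: homo_leq => [//|y x' z|n]; first exact: le_trans.
elim: n c x => [|n IHn] c x /=; case: ifP => // _.
  by rewrite mulr_ge0//; exact: (truncated_payoff_ge0 0).
by rewrite ler_wpM2l// IHn.
Qed.

Lemma truncated_payoff_cvg c x :
  (truncated_payoff n c x)%:E @[n --> \oo] --> (payoff (run c x))%:E.
Proof.
apply: cvg_near_cst; rewrite /payoff.
case E : first_time => [m|]; last first.
  by apply: nearW => n; rewrite truncated_payoffE E.
by exists m => // n /= mn; rewrite truncated_payoffE E mn.
Qed.

End payoff.

(** * Linear recursions of skip-free type *)

Section harmonic.
Set Implicit Arguments.
Unset Strict Implicit.
Context {R : realType} (p : nat -> R) (v : R).

(** The part of [E f (x + 1 - C)] that comes from nonnegative arguments. *)
Definition conv (f : nat -> R) (x : nat) : R :=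
  \sum_(k < x.+2) p k * f (x.+1 - k)%N.

Lemma conv_recl f x :
  conv f x = p 0%N * f x.+1 + \sum_(k < x.+1) p k.+1 * f (x - k)%N.
Proof. by rewrite /conv big_ord_recl. Qed.

Lemma eq_conv f g x : (forall n, (n <= x.+1)%N -> f n = g n) ->
  conv f x = conv g x.
Proof. by move=> fg; apply: eq_bigr => k _; rewrite fg ?leq_subr. Qed.

Lemma conv_linear a b f g x :
  conv (fun n => a * f n + b * g n) x = a * conv f x + b * conv g x.
Proof.
rewrite /conv !mulr_sumr -big_split/=; apply: eq_bigr => k _.
by rewrite mulrDr !(mulrCA (p k)).
Qed.

Lemma conv_scale a f x : conv (fun n => a * f n) x = a * conv f x.
Proof. by rewrite /conv mulr_sumr; apply: eq_bigr => k _; rewrite mulrCA. Qed.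

Hypotheses (p_ge0 : forall k, 0 <= p k) (p0_gt0 : 0 < p 0%N).
Hypothesis p_sum_le1 : forall n, \sum_(k < n) p k <= 1.
Hypotheses (hv : 0 < v <= 1) (hnd : ~ (p 0%N + p 1%N = 1 /\ v = 1)).

Let v_gt0 : 0 < v. Proof. by case/andP: hv. Qed.

(** Since [p 0 > 0], the recursion at [x] can be solved for the value at
    [x + 1]; a solution is determined by its value at 0. *)
Lemma harmonic_eq0 (u : nat -> R) y : u 0%N = 0 ->
  (forall x, (x < y)%N -> u x = v * conv u x) ->
  forall x, (x <= y)%N -> u x = 0.
Proof.
move=> u0 hu; elim/ltn_ind => -[//|x] IHx xy.
have := hu x xy; rewrite IHx ?(ltnW xy)// conv_recl big1 => [|k _]; last first.
  by rewrite IHx ?mulr0// ?ltnS ?leq_subr// (leq_trans (leq_subr _ _))// ltnW.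
move/esym/eqP; rewrite addr0 !mulf_eq0 (gt_eqF v_gt0) (gt_eqF p0_gt0)/=.
by move/eqP.
Qed.

(** Used in place of the strong Markov property: two passage functions that
    satisfy the same recursion are proportional, which is the factorization at
    an intermediate level. *)
Lemma harmonic_proportional (f g : nat -> R) y :
  (forall x, (x < y)%N -> f x = v * conv f x) ->
  (forall x, (x < y)%N -> g x = v * conv g x) ->
  forall x, (x <= y)%N -> f x * g 0%N = f 0%N * g x.
Proof.
move=> hf hg x xy; apply/eqP; rewrite -subr_eq0; apply/eqP.
have := @harmonic_eq0 (fun n => g 0%N * f n + - f 0%N * g n) y.
rewrite mulNr mulrC subrr => /(_ erefl) H; rewrite mulrC -mulNr; apply: H xy.
move=> {}x xy; rewrite conv_linear (hf x xy) (hg x xy) mulrDr.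
by rewrite !(mulrCA v).
Qed.

(** In state [m] either mass is lost, by discounting or by a jump below 0, or
    the walk can jump to a smaller nonnegative state.  If no claim of size
    between 2 and [m + 1] has positive probability, the sum is [p 0 + p 1], and
    [v * (p 0 + p 1) < 1] is what the nondegeneracy assumption says. *)
Lemma loss_or_descent m : v * (\sum_(k < m.+2) p k) < 1 \/
  exists2 k : 'I_m.+1, (0 < k)%N & 0 < p k.+1.
Proof.
case: (pselect (exists2 k : 'I_m.+1, (0 < k)%N & 0 < p k.+1)) => [|nk].
  by right.
left; rewrite 2!big_ord_recl/= big1 ?addr0 => [|k _]; last first.
  apply/eqP; rewrite eq_le p_ge0 andbT leNgt; apply/negP => pk.
  by apply: nk; exists (lift ord0 k).
have p01 : p 0%N + p 1%N <= 1.
  by have := p_sum_le1 2; rewrite !big_ord_recl big_ord0 addr0.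
have p01_gt0 : 0 < p 0%N + p 1%N by rewrite ltr_wpDr.
case/andP: hv => _; rewrite le_eqVlt => /orP[/eqP v1|v1].
  rewrite v1 mul1r lt_neqAle p01 andbT; apply/eqP => e.
  exact: hnd.
by apply: lt_le_trans p01; rewrite gtr_pMl.
Qed.

Lemma vsum_le1 m : v * (\sum_(k < m) p k) <= 1.
Proof. by case/andP: hv => v0 v1; rewrite mulr_ile1 ?sumr_ge0// ltW. Qed.

(** With [f] increasing up to [x], the recursion says that
    [v * p 0 * (f (x + 1) - f x)] is the mass lost at [x], weighted by [f x],
    plus the average decrease of [f] over downward jumps; one of the two is
    positive by the previous alternative. *)
Lemma harmonic_increasing (f : nat -> R) : 0 < f 0%N ->
  (forall x, f x = v * conv f x) -> forall x, f x < f x.+1.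
Proof.
move=> f0 hf; elim/ltn_ind => x IHx.
have mono i j : (i < j)%N -> (j <= x)%N -> f i < f j.
  elim: j => // j IHj; rewrite ltnS leq_eqVlt => /orP[/eqP->|ij] jx.
    exact: IHx.
  by rewrite (lt_trans (IHj ij (ltnW jx)))// IHx.
have le_fx k : f (x - k)%N <= f x.
  have := leq_subr k x; rewrite leq_eqVlt => /orP[/eqP->//|kx].
  by rewrite ltW// mono.
have fx : 0 < f x.
  by rewrite (lt_le_trans f0)//; have := le_fx x; rewrite subnn.
set S := \sum_(k < x.+1) p k.+1 * (f x - f (x - k)%N).
have defect : v * p 0%N * (f x.+1 - f x)
    = f x * (1 - v * \sum_(k < x.+2) p k) + v * S.
  have -> : S = (\sum_(k < x.+1) p k.+1) * f x
              - \sum_(k < x.+1) p k.+1 * f (x - k)%N.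
    by rewrite mulr_suml -sumrB; apply: eq_bigr => k _; rewrite mulrBr.
  have := hf x; rewrite conv_recl [\sum_(k < x.+2) _]big_ord_recl /=.
  set S1 := \sum_(k < _) _; set S2 := (\sum_(k < _) _).
  by move=> hfx; lra.
have S_ge0 : 0 <= S by apply: sumr_ge0 => k _; rewrite mulr_ge0// subr_ge0.
rewrite -subr_gt0 -(pmulr_rgt0 _ (mulr_gt0 v_gt0 p0_gt0)) defect.
case: (loss_or_descent x) => [lt1|[k k0 pk]].
  by rewrite ltr_wpDr ?mulr_gt0 ?subr_gt0// mulr_ge0// ltW.
rewrite ltr_wpDl//; first by rewrite mulr_ge0 ?(ltW fx)// subr_ge0 vsum_le1.
rewrite mulr_gt0// /S (bigD1 k)//= ltr_wpDr//.
  by apply: sumr_ge0 => i _; rewrite mulr_ge0// subr_ge0.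
rewrite mulr_gt0// subr_gt0 mono// ltn_subrL k0/=.
by rewrite -ltnS (leq_trans _ (ltn_ord k)).
Qed.

(** The smallest minimizer [m] is considered.  If [G m < 0], loss of mass makes
    the discounted average of [G] over the next state larger than [G m], and so
    does a jump to a smaller state, where [G] is strictly larger than [G m]. *)
Lemma minimum_principle (G : nat -> R) b :
  (forall x, (x <= b)%N -> v * conv (fun n => G (minn n b)) x <= G x) ->
  forall x, (x <= b)%N -> 0 <= G x.
Proof.
move=> super.
pose minimizer m := (m <= b)%N && [forall j : 'I_b.+1, G m <= G j].
have exm : exists m, minimizer m.
  case: (@arg_minP _ _ 'I_b.+1 ord0 predT G isT) => i _ imin.
  exists i; rewrite /minimizer -ltnS ltn_ord.
  by apply/forallP => j; exact: imin.
case: (ex_minnP exm) => m /andP[mb /forallP mmin] mleast.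
have Gm j : (j <= b)%N -> G m <= G j.
  by rewrite -ltnS => jb; exact: (mmin (Ordinal jb)).
have Gm_lt j : (j < m)%N -> G m < G j.
  move=> jm; rewrite lt_neqAle Gm ?(leq_trans (ltnW jm))// andbT.
  apply/eqP => e; suff /mleast : minimizer j by rewrite leqNgt jm.
  rewrite /minimizer (leq_trans (ltnW jm))//.
  by apply/forallP => i; rewrite -e.
suff G0 : 0 <= G m by move=> x /Gm; exact: le_trans.
rewrite leNgt; apply/negP => G0.
set D := \sum_(k < m.+2) p k * (G (minn (m.+1 - k) b) - G m).
have balance : v * D <= G m * (1 - v * \sum_(k < m.+2) p k).
  have -> : D = conv (fun n => G (minn n b)) m - (\sum_(k < m.+2) p k) * G m.
    by rewrite mulr_suml -sumrB; apply: eq_bigr => k _; rewrite mulrBr.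
  by have := super m mb; lra.
have D_ge0 k : 0 <= p k * (G (minn (m.+1 - k) b) - G m).
  by rewrite mulr_ge0// subr_ge0 Gm// geq_minr.
case: (loss_or_descent m) => [lt1|[k k0 pk]].
  suff : v * D < 0 by rewrite ltNge mulr_ge0 ?(ltW v_gt0)// sumr_ge0.
  by apply: le_lt_trans balance _; rewrite nmulr_rlt0// subr_gt0.
suff : 0 < v * D.
  rewrite ltNge (le_trans balance)// nmulr_rle0// subr_ge0.
  exact: vsum_le1.
rewrite mulr_gt0// /D (bigD1 (lift ord0 k))//= ltr_wpDr ?sumr_ge0//.
rewrite mulr_gt0// subr_gt0 Gm_lt// subSS (leq_ltn_trans (geq_minl _ _))//.
by rewrite ltn_subrL k0/= -ltnS (leq_trans _ (ltn_ord k)).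
Qed.

End harmonic.

(** * First-step analysis *)

Section first_step.
Set Implicit Arguments.
Unset Strict Implicit.
Context {R : realType} {d : measure_display} {T : measurableType d}.
Context {P : probability T R} {p : nat -> R} {C : nat -> {RV P >-> nat}}.
Hypothesis hC : iid_with_pmf C p.
Local Open Scope ereal_scope.

Lemma measurable_claim m k : measurable (C m @^-1` [set k]).
Proof. by rewrite -[X in measurable X]setTI; exact: measurable_funP. Qed.

Lemma bigcup_claim m : \bigcup_k (C m @^-1` [set k]) = [set: T].
Proof. by apply/seteqP; split=> // t _; exists (C m t). Qed.

Lemma measurable_fun_claim (m : nat) (F : nat -> T -> \bar R) :
  (forall k, measurable_fun [set: T] (F k)) ->
  measurable_fun [set: T] (fun t => F (C m t) t).
Proof.
move=> mF _ B mB; rewrite setTI.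
have -> : (fun t => F (C m t) t) @^-1` B =
    \bigcup_k (C m @^-1` [set k] `&` F k @^-1` B).
  apply/seteqP; split=> [t FB|t [k _ [/= <-]]//].
  by exists (C m t).
apply: bigcup_measurable => k _; apply: measurableI.
  exact: measurable_claim.
by rewrite -[X in measurable X]setTI; exact: mF.
Qed.

(** Partition according to the value of the claim [m]. *)
Lemma integral_claim (m : nat) (A : set T) (F : nat -> T -> \bar R) :
  measurable A ->
  (forall k, measurable_fun [set: T] (F k)) -> (forall k t, 0 <= F k t) ->
  \int[P]_(t in A) F (C m t) t =
  \sum_(k <oo) \int[P]_(t in A `&` C m @^-1` [set k]) F k t.
Proof.
move=> mA mF F0.
rewrite -[in LHS](setIT A) -(bigcup_claim m) setI_bigcupr.
rewrite ge0_integral_bigcup//.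
- apply: eq_eseriesr => k _; apply: eq_integral => t.
  by rewrite inE => -[_ /= ->].
- by move=> k; apply: measurableI => //; exact: measurable_claim.
- by apply: measurable_funTS; exact: measurable_fun_claim.
- apply/trivIsetP => i j _ _ ij; apply/seteqP; split=> // t [[_ /= ti]] [_ /= tj].
  by rewrite -ti -tj eqxx in ij.
Qed.

(** Events on which finitely many claims are prescribed.  Independence enters
    only through the probabilities of these events. *)
Definition history (J : seq nat) (a : nat -> nat) : set T :=
  \bigcap_(j in [set` J]) (C j @^-1` [set a j]).

Lemma measurable_history J a : measurable (history J a).
Proof.
by apply: bigcap_measurableType => // j _; exact: measurable_claim.
Qed.

Lemma history_cons J a m k : m \notin J ->
  history (m :: J) (fun j => if j == m then k else a j) =
  history J a `&` C m @^-1` [set k].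
Proof.
move=> mJ; apply/seteqP; split=> t.
  move=> h; split=> [j /= jJ|]; last first.
    by have /= := h m (mem_head _ _); rewrite eqxx.
  have /= := h j (mem_behead (s := m :: J) jJ).
  by rewrite (negbTE (memPn mJ _ jJ)).
move=> [h hm] j /=; rewrite inE; case: eqVneq => [->//|_ /=].
exact: h.
Qed.

Lemma probability_history J a : uniq J ->
  P (history J a) = \prod_(j <- J) (p (a j))%:E.
Proof.
move=> uJ; have [indep law] := hC.
rewrite /history (indep J (fun j => [set a j]) uJ)//.
by apply: eq_bigr => j _; exact: law.
Qed.

Lemma probability_history_claim J a m k : uniq J -> m \notin J ->
  P (history J a `&` C m @^-1` [set k]) = (p k)%:E * P (history J a).
Proof.
move=> uJ mJ; rewrite -history_cons// !probability_history/= ?mJ//.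
rewrite big_cons eqxx; congr (_ * _); rewrite big_seq [RHS]big_seq.
by apply: eq_bigr => j jJ; rewrite (negbTE (memPn mJ _ jJ)).
Qed.

Lemma pmf_ge0 k : (0 <= p k)%R.
Proof. by rewrite -lee_fin -(hC.2 0%N k). Qed.

Lemma expectation_claim m (f : nat -> \bar R) : (forall k, 0 <= f k) ->
  \int[P]_t f (C m t) = \sum_(k <oo) (p k)%:E * f k.
Proof.
move=> f0; rewrite (@integral_claim m setT (fun k => cst (f k)))//; last first.
  by move=> k t; exact: f0.
apply: eq_eseriesr => k _; rewrite setTI integral_cst; last first.
  exact: measurable_claim.
by rewrite muleC; congr (_ * _); exact: hC.2.
Qed.

Section chain.
Variables (next : int -> nat -> int) (stop : pred int) (g : int -> R) (v : R).
Hypotheses (v0 : (0 <= v)%R) (g0 : forall x, stop x -> (0 <= g x)%R).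

Let payoff_at m n x t :=
  (truncated_payoff next stop g v n (fun i => C (m + i)%N t) x)%:E.

Definition chain_value x : \bar R :=
  'E_P[fun t => payoff stop g v (run next (C ^~ t) x)].

Fixpoint truncated_value (n : nat) (x : int) : \bar R :=
  if stop x then (g x)%:E
  else if n is n'.+1 then
    v%:E * \sum_(k <oo) (p k)%:E * truncated_value n' (next x k)
  else 0.

Lemma payoff_at_ge0 m n x t : 0 <= payoff_at m n x t.
Proof. by rewrite lee_fin truncated_payoff_ge0. Qed.

Lemma payoff_atS m n x t : ~~ stop x ->
  payoff_at m n.+1 x t = v%:E * payoff_at m.+1 n (next x (C m t)) t.
Proof.
rewrite /payoff_at /= => /negbTE ->; rewrite EFinM addn0; congr (_ * _%:E).
by congr truncated_payoff; apply/funext => i; rewrite addnS.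
Qed.

Lemma measurable_payoff_at m n x : measurable_fun [set: T] (payoff_at m n x).
Proof.
elim: n m x => [|n IHn] m x.
  by rewrite /payoff_at /=; case: ifP => _; exact: measurable_cst.
case: (boolP (stop x)) => sx.
  by rewrite /payoff_at /= sx; exact: measurable_cst.
rewrite (_ : payoff_at m n.+1 x =
  fun t => v%:E * payoff_at m.+1 n (next x (C m t)) t); last first.
  by apply/funext => t; exact: payoff_atS.
apply: measurable_funeM.
exact: (measurable_fun_claim m (fun k => IHn m.+1 (next x k))).
Qed.

Lemma truncated_value_ge0 n x : 0 <= truncated_value n x.
Proof.
elim: n x => [|n IHn] x /=; case: ifPn => [/g0|]; rewrite ?lee_fin// => _.
apply: mule_ge0; rewrite ?lee_fin//; apply: nneseries_ge0 => k _ _.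
by rewrite mule_ge0 ?lee_fin ?pmf_ge0.
Qed.

(** The Markov property at a deterministic time, in integrated form: whatever
    values are prescribed for earlier claims, the payoff computed from the
    claims from [m] on contributes the factor [truncated_value].  Prescribing a
    history is what lets the induction split on one more claim. *)
Lemma integral_payoff_at n m x J a : uniq J -> {in J, forall j, (j < m)%N} ->
  \int[P]_(t in history J a) payoff_at m n x t =
  truncated_value n x * P (history J a).
Proof.
elim: n m x J a => [|n IHn] m x J a uJ Jm.
  rewrite /payoff_at /=; case: ifP => _; rewrite integral_cst//;
  exact: measurable_history.
case: (boolP (stop x)) => sx.
  rewrite /payoff_at /= sx integral_cst//; exact: measurable_history.
under eq_integral do rewrite payoff_atS//.
rewrite ge0_integralZl//; last 3 first.
- exact: measurable_history.
- apply: measurable_funTS.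
  exact: (measurable_fun_claim m (fun k => measurable_payoff_at m.+1 n _)).
- by move=> t _; exact: payoff_at_ge0.
rewrite (@integral_claim m _ (fun k => payoff_at m.+1 n (next x k))); last 3 first.
- exact: measurable_history.
- by move=> k; exact: measurable_payoff_at.
- by move=> k t; exact: payoff_at_ge0.
rewrite /= (negbTE sx) -muleA; congr (_ * _).
have mJ : m \notin J by apply/negP => /Jm; rewrite ltnn.
transitivity (\sum_(k <oo) P (history J a) *
    ((p k)%:E * truncated_value n (next x k))); last first.
  rewrite -[P _]fineK ?fin_num_measure//; last exact: measurable_history.
  rewrite nneseriesZl 1?muleC// => k _.
  by rewrite mule_ge0 ?lee_fin ?pmf_ge0 ?truncated_value_ge0.
apply: eq_eseriesr => k _; rewrite -(history_cons _ _ mJ) IHn.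
- by rewrite history_cons// probability_history_claim// muleCA [RHS]muleC -muleA.
- by rewrite /= mJ.
- by move=> j; rewrite inE => /orP[/eqP->|/Jm/ltnW]; rewrite ?ltnS.
Qed.

Lemma expectation_truncated n x :
  \int[P]_t (truncated_payoff next stop g v n (C ^~ t) x)%:E
  = truncated_value n x.
Proof.
have := @integral_payoff_at n 0 x [::] id.
by rewrite /history set_nil bigcap_set0 probability_setT mule1; exact.
Qed.

Lemma truncated_value_homo x :
  {homo (truncated_value ^~ x) : m n / (m <= n)%N >-> m <= n}.
Proof.
move=> m n mn; rewrite -!expectation_truncated; apply: ge0_le_integral => //.
- by move=> t _; exact: (payoff_at_ge0 0).
- exact: (measurable_payoff_at 0).
- exact: (measurable_payoff_at 0).
- by move=> t _; rewrite lee_fin truncated_payoff_homo.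
Qed.

Lemma truncated_value_cvg x : truncated_value n x @[n --> \oo] --> chain_value x.
Proof.
rewrite /chain_value unlock.
under eq_fun do rewrite -expectation_truncated.
rewrite (_ : (\int[P]_t _) = \int[P]_t lim (payoff_at 0 n x t @[n --> \oo])).
  apply: (@cvg_monotone_convergence _ _ _ P setT measurableT
    (fun n => payoff_at 0 n x)).
  - by move=> n; exact: measurable_payoff_at.
  - by move=> n t _; exact: payoff_at_ge0.
  - by move=> t _ m n mn; rewrite lee_fin truncated_payoff_homo.
apply: eq_integral => t _; apply/esym/cvg_lim => //.
exact: truncated_payoff_cvg.
Qed.

Lemma value_ge0 x : 0 <= chain_value x.
Proof.
apply: (cvge_to_ge (@truncated_value_cvg x)).
by apply: nearW => n; exact: truncated_value_ge0.
Qed.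

Lemma value_stop x : stop x -> chain_value x = (g x)%:E.
Proof.
move=> sx; rewrite /chain_value.
under [X in expectation _ X]eq_fun do rewrite payoff_stop//=.
exact: expectation_cst.
Qed.

(** Both sides are monotone limits in the horizon.  The series over the next
    claim is read as an expectation so that monotone convergence applies to it
    as well. *)
Lemma value_first_step x : ~~ stop x ->
  chain_value x = v%:E * \sum_(k <oo) (p k)%:E * chain_value (next x k).
Proof.
move=> sx; rewrite -(cvg_lim _ (@truncated_value_cvg x))//; apply/cvg_lim => //.
rewrite -(cvg_shiftS (truncated_value ^~ x)) /= (negbTE sx).
apply: cvgeZl => //.
rewrite -(expectation_claim 0 (f := chain_value \o next x))//; last first.
  by move=> k; exact: value_ge0.
rewrite (_ : (fun n => _) = fun n =>
    \int[P]_t truncated_value n (next x (C 0%N t))); last first.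
  apply/funext => n.
  rewrite (expectation_claim 0 (f := fun k => truncated_value n (next x k)))//.
  by move=> k; exact: truncated_value_ge0.
rewrite (_ : (\int[P]_t _) = \int[P]_t
    lim (truncated_value n (next x (C 0%N t)) @[n --> \oo])).
  apply: (@cvg_monotone_convergence _ _ _ P setT measurableT
    (fun n t => truncated_value n (next x (C 0%N t)))).
  - by move=> n; apply: (measurable_fun_claim 0
      (F := fun k => cst (truncated_value n (next x k)))) => k.
  - by move=> n t _; exact: truncated_value_ge0.
  - by move=> t _ m n mn; exact: truncated_value_homo.
apply: eq_integral => t _; apply/esym/cvg_lim => //.
exact: truncated_value_cvg.
Qed.

(** A nonnegative function that dominates the reward and is superharmonic on an
    invariant set [S] dominates the value there: it dominates every truncated
    value, by induction on the horizon. *)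
Lemma value_le (S : pred int) (H : int -> \bar R) :
  (forall x k, S x -> ~~ stop x -> S (next x k)) ->
  (forall x, 0 <= H x) ->
  (forall x, S x -> stop x -> (g x)%:E <= H x) ->
  (forall x, S x -> ~~ stop x ->
     v%:E * \sum_(k <oo) (p k)%:E * H (next x k) <= H x) ->
  forall x, S x -> chain_value x <= H x.
Proof.
move=> Snext H0 Hstop Hsuper x Sx.
apply: (cvge_to_le (@truncated_value_cvg x)); apply: nearW => n.
elim: n x Sx => [|n IHn] x Sx /=; case: ifPn => sx; rewrite ?Hstop//.
apply: le_trans (Hsuper x Sx sx); apply: lee_wpmul2l; rewrite ?lee_fin//.
apply: lee_nneseries => k.
  by move=> _ _; rewrite mule_ge0 ?lee_fin ?pmf_ge0 ?truncated_value_ge0.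
by move=> _; rewrite lee_wpmul2l ?lee_fin ?pmf_ge0// IHn// Snext.
Qed.

End chain.
End first_step.

Arguments chain_value {R d T P} C next stop g v x.

(** * Finite recursions for the free walk *)

Section recursion.
Set Implicit Arguments.
Unset Strict Implicit.
Context {R : realType} {d : measure_display} {T : measurableType d}.
Context {P : probability T R} {p : nat -> R} {C : nat -> {RV P >-> nat}}.
Hypothesis hC : iid_with_pmf C p.
Hypothesis hEC : ('E_P[fun t => (C 0%N t)%:R] < +oo)%E.

(** Contribution of a claim [k] that ruins the state [x], when the value at
    [- j] is [g j]. *)
Definition jump (g : nat -> R) (x k : nat) : R :=
  if (x.+1 < k)%N then g (k - x.+1)%N else 0.

Definition tail (g : nat -> R) (x : nat) : R :=
  fine (\int[P]_t (jump g x (C 0%N t))%:E).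

(** The growth condition under which [tail] is finite as soon as the mean claim
    is. *)
Definition sublinear (g : nat -> R) : Prop :=
  forall j, (0 < j)%N -> 0 <= g j <= j%:R.

Lemma jump_bounds g x k : sublinear g -> 0 <= jump g x k <= k%:R.
Proof.
move=> hg; rewrite /jump; case: ifP => [xk|_]; last by rewrite lexx ler0n.
have /andP[g0 gk] : 0 <= g (k - x.+1)%N <= (k - x.+1)%:R.
  by apply: hg; rewrite subn_gt0.
by rewrite g0 (le_trans gk)// ler_nat leq_subr.
Qed.

Lemma measurable_claimT (m : nat) (f : nat -> \bar R) :
  measurable_fun [set: T] (fun t => f (C m t)).
Proof. exact: (measurable_fun_claim m (F := fun k => cst (f k))). Qed.

Lemma expectation_jump_lty g x : sublinear g ->
  (\int[P]_t (jump g x (C 0%N t))%:E < +oo)%E.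
Proof.
move=> hg; apply: le_lt_trans hEC; rewrite unlock.
apply: ge0_le_integral => //.
- by move=> t _; rewrite lee_fin; case/andP: (jump_bounds x (C 0%N t) hg).
- exact: (measurable_claimT 0 (fun k => (jump g x k)%:E)).
- exact: (measurable_claimT 0 (fun k => (k%:R)%:E)).
- by move=> t _; rewrite lee_fin; case/andP: (jump_bounds x (C 0%N t) hg).
Qed.

Lemma tailE g x : sublinear g ->
  (tail g x)%:E = (\int[P]_t (jump g x (C 0%N t))%:E)%E.
Proof.
move=> hg; rewrite fineK// ge0_fin_numE ?expectation_jump_lty//.
apply: integral_ge0 => t _; rewrite lee_fin.
by case/andP: (jump_bounds x (C 0%N t) hg).
Qed.

Lemma tail_ge0 g x : sublinear g -> 0 <= tail g x.
Proof.
move=> hg; rewrite -lee_fin tailE//; apply: integral_ge0 => t _.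
by rewrite lee_fin; case/andP: (jump_bounds x (C 0%N t) hg).
Qed.

Lemma eq_tail g g' x : (forall j, (0 < j)%N -> g j = g' j) ->
  tail g x = tail g' x.
Proof.
move=> gg'; rewrite /tail; congr fine; apply: eq_integral => t _.
by rewrite /jump; case: ifP => // xk; rewrite gg'// subn_gt0.
Qed.

Lemma tail0 x : tail (fun=> 0) x = 0.
Proof.
rewrite /tail (_ : (fun t => _) = cst 0%E) ?integral_cst ?mul0e//.
by apply/funext => t; rewrite /jump; case: ifP.
Qed.

Lemma series_split (F : nat -> \bar R) h g x :
  (forall n, 0 <= h n) -> sublinear g ->
  (forall k, (k < x.+2)%N -> F k = (h (x.+1 - k)%N)%:E) ->
  (forall k, (x.+1 < k)%N -> F k = (g (k - x.+1)%N)%:E) ->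
  (\sum_(k <oo) (p k)%:E * F k = (conv p h x + tail g x)%:E)%E.
Proof.
move=> h0 hg Fh Fg.
have p0 := pmf_ge0 hC.
have F0 k : (0 <= F k)%E.
  case: (ltnP k x.+2) => kx; first by rewrite Fh ?lee_fin.
  have /hg/andP[gk _] : (0 < k - x.+1)%N by rewrite subn_gt0.
  by rewrite Fg// lee_fin.
have J0 k : (0 <= (jump g x k)%:E)%E.
  by rewrite lee_fin; case/andP: (jump_bounds x k hg).
rewrite EFinD tailE// (expectation_claim hC 0 (f := fun k => (jump g x k)%:E))//.
rewrite (nneseries_split 0 x.+2) => [|k _]; last first.
  by rewrite mule_ge0 ?lee_fin.
rewrite [in RHS](nneseries_split 0 x.+2) => [|k _]; last first.
  by rewrite mule_ge0 ?lee_fin// -lee_fin.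
have -> : (\sum_(0 <= k < 0 + x.+2) ((p k)%:E * (jump g x k)%:E) = 0)%E.
  rewrite big_nat big1// => k; rewrite add0n ltnS /= => kx.
  by rewrite /jump ltnNge kx mule0.
rewrite add0e; congr (_ + _)%E.
  rewrite add0n big_mkord -sumEFin; apply: eq_bigr => k _.
  by rewrite Fh// EFinM.
rewrite eseries_cond [RHS]eseries_cond; apply: eq_eseriesr => k.
rewrite add0n /= => kx.
by rewrite Fg// /jump kx.
Qed.

Definition climb (x : int) (k : nat) : int := x + 1 - k%:Z.

Lemma walk_run c x : walk c x = run climb c x.
Proof.
apply/funext; elim=> [|n IHn]; first by rewrite /walk big_ord0 subr0 addr0.
rewrite /= -IHn /walk /climb big_ord_recr/= -addn1 PoszD.
by rewrite opprD !addrA; congr (_ - _); rewrite addrAC.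
Qed.

Section walk_value.
Variables (stop : pred int) (g : int -> R) (v : R).
Hypotheses (hv : 0 < v <= 1) (hg : forall x, stop x -> 0 <= g x <= 1).
Hypothesis stop_neg : forall x : int, x < 0 -> stop x.

Local Notation value := (chain_value C climb stop g v).

Let v0 : 0 <= v. Proof. by case/andP: hv => /ltW. Qed.
Let g0 x : stop x -> 0 <= g x. Proof. by case/hg/andP. Qed.

Lemma pmf_sum1 : (\sum_(k <oo) (p k)%:E = 1)%E.
Proof.
transitivity (\sum_(k <oo) (p k)%:E * cst 1 k)%E.
  by apply: eq_eseriesr => k _; rewrite mule1.
rewrite -(expectation_claim hC 0) => [|k]; last exact: lee01.
by rewrite integral_cst// mul1e; exact: probability_setT.
Qed.

Lemma walk_value_bounds x : (0 <= value x <= 1)%E.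
Proof.
rewrite (value_ge0 hC)//=.
apply: (@value_le _ _ _ _ _ _ hC climb stop g v v0 g0 predT (fun=> 1%E)) => //.
  by move=> y _ /hg/andP[_]; rewrite lee_fin.
move=> y _ _; under eq_eseriesr do rewrite mule1.
by rewrite pmf_sum1 mule1 lee_fin; case/andP: hv.
Qed.

Lemma walk_value_fin x : (fine (value x))%:E = value x.
Proof.
apply: fineK; rewrite ge0_fin_numE; last by case/andP: (walk_value_bounds x).
by case/andP: (walk_value_bounds x) => _ /le_lt_trans; apply; exact: ltry.
Qed.

(** First-step analysis for the free walk, with the claims that ruin the walk
    collected in [tail]: there the value is the reward itself. *)
Lemma walk_value_rec (x : nat) : ~~ stop x%:Z ->
  fine (value x%:Z) = v * (conv p (fun n => fine (value n%:Z)) x +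
                           tail (fun j => g (- j%:Z)) x).
Proof.
move=> sx; apply: EFin_inj; rewrite walk_value_fin (value_first_step hC)//.
rewrite EFinM; congr (_ * _)%E; apply: series_split.
- by move=> n; apply: fine_ge0; case/andP: (walk_value_bounds n).
- move=> j j0; have /hg/andP[-> gj] : stop (- j%:Z).
    by apply: stop_neg; rewrite oppr_lt0.
  by rewrite (le_trans gj)// ler1n.
- move=> k kx; rewrite walk_value_fin; congr chain_value.
  by rewrite /climb -subzn// -addn1.
- move=> k kx; have kE : climb x k = - (k - x.+1)%:Z.
    by rewrite /climb -subzn 1?ltnW// -[x.+1]addn1 opprB.
  rewrite kE value_stop//; apply: stop_neg.
  by rewrite oppr_lt0 ltz_nat subn_gt0.
Qed.

End walk_value.
End recursion.
Arguments tail {R d T P} C g x.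

(** * Recursions for W and Z *)

Section scale.
Set Implicit Arguments.
Unset Strict Implicit.
Context {R : realType} {d : measure_display} {T : measurableType d}.
Context {P : probability T R} {p : nat -> R} {C : nat -> {RV P >-> nat}}.
Hypotheses (hC : iid_with_pmf C p) (hp0 : 0 < p 0%N).
Hypothesis hEC : ('E_P[fun t => (C 0%N t)%:R] < +oo)%E.
Variable v : R.
Hypothesis hv : 0 < v <= 1.
Hypothesis hnd : ~ (p 0%N + p 1%N = 1 /\ v = 1).

Lemma pmf_sum_le1 n : \sum_(k < n) p k <= 1.
Proof.
rewrite -lee_fin -(pmf_sum1 hC) -sumEFin -(big_mkord xpredT (fun k => (p k)%:E)).
by apply: nneseries_lim_ge => k _; rewrite lee_fin (pmf_ge0 hC).
Qed.

Let v0 : 0 <= v. Proof. by case/andP: hv => /ltW. Qed.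

Definition exits (y : nat) : pred int := fun z => (z < 0) || (y%:Z <= z).
Definition at_top (y : nat) (z : int) : R := if y%:Z <= z then 1 else 0.

(** [E_x[v ^ tau_y^+; tau_y^+ < tau_(-1)^-]], with both exits taken as one
    stopping set. *)
Definition climb_before_ruin (y : nat) (x : nat) : R :=
  fine (chain_value C climb (exits y) (at_top y) v x%:Z).
Local Notation phi := climb_before_ruin.

(** The two hitting times are those of disjoint sets, so the earlier one is the
    hitting time of the union, and the reward tells which set was hit. *)
Lemma payoff_exits (y : nat) (X : nat -> int) :
  payoff (exits y) (at_top y) v X =
  if hit_above X y is Some n then
    if time_lt (Some n) (hit_below X (-1)) then v ^+ n else 0
  else 0.
Proof.
have neg1 z : (z <= -1 :> int) = (z < 0) by rewrite -ltzD1 addNr.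
rewrite /payoff; case E : first_time => [n|]; last first.
  move/first_time_none: E => nX.
  suff -> : hit_above X y = None by [].
  by apply/first_time_none => n; have := nX n; rewrite /exits/= negb_or => /andP[].
move/first_time_some: E => [/= sn nmin]; rewrite /at_top; case: ifPn => yn.
  have -> : hit_above X y = Some n.
    apply/first_time_some; split=> // m /nmin.
    by rewrite /exits/= negb_or => /andP[].
  rewrite mulr1 /=; case E : (hit_below X (-1)) => [m|//].
  suff -> : (n < m)%N by [].
  move/first_time_some: E => [Xm _]; rewrite ltnNge leq_eqVlt; apply/norP; split.
    apply: contraL Xm => /eqP ->; rewrite neg1 -leNgt.
    exact: le_trans yn.
  by apply/negP => /nmin; rewrite /exits /= -neg1 Xm.
have Xn : X n < 0 by move: sn; rewrite /exits (negbTE yn) orbF.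
have -> : hit_below X (-1) = Some n.
  apply/first_time_some; rewrite neg1; split=> // m /nmin.
  by rewrite /exits/= negb_or neg1 => /andP[].
rewrite mulr0; case E : (hit_above X y) => [m|//] /=.
case: ifP => // /nmin; move/first_time_some: E => [ym _].
by rewrite /exits/= ym orbT.
Qed.

Lemma W_phi (y : nat) : W C p v y%:Z = (p 0%N * phi y 0)^-1.
Proof.
rewrite /W /phi /chain_value /=; congr (_ * fine _)^-1.
congr expectation; apply/funext => t.
by rewrite -payoff_exits walk_run.
Qed.

Lemma exits_bounds y z : exits y z -> 0 <= at_top y z <= 1.
Proof. by rewrite /at_top; case: ifP; rewrite lexx ler01. Qed.

Lemma exits_neg y z : z < 0 -> exits y z.
Proof. by rewrite /exits => ->. Qed.

Lemma phi_rec y x : (x < y)%N -> phi y x = v * conv p (phi y) x.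
Proof.
move=> xy; rewrite /phi.
rewrite (walk_value_rec hC hEC hv (@exits_bounds y) (@exits_neg y)); last first.
  by rewrite /exits/= lez_nat -ltnNge.
rewrite (@eq_tail _ _ _ _ _ _ (fun=> 0)) ?tail0 ?addr0// => j j0.
rewrite /at_top; case: ifP => // yj.
have : (0 : int) <= - j%:Z by exact: le_trans yj.
by rewrite oppr_ge0 lez_nat leqNgt j0.
Qed.

Lemma phi_top y : phi y y = 1.
Proof.
rewrite /phi value_stop/=; last by rewrite /exits lexx orbT.
by rewrite /at_top lexx.
Qed.

Lemma phi_ge0 y x : 0 <= phi y x.
Proof.
apply: fine_ge0; apply: (value_ge0 hC) => // z.
by case/exits_bounds/andP.
Qed.

Lemma phi_gt0 y : 0 < phi y 0.
Proof.
rewrite lt_neqAle phi_ge0 andbT eq_sym; apply/eqP => phi0.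
have := harmonic_eq0 hp0 hv phi0 (@phi_rec y) (leqnn y).
by move/eqP; rewrite phi_top oner_eq0.
Qed.

(** To reach [y] from 0 the walk passes through [x], because it climbs by at
    most one per period. *)
Lemma phi_split y x : (x <= y)%N -> phi y 0 = phi x 0 * phi y x.
Proof.
move=> xy; rewrite -[LHS]mul1r -(phi_top x).
apply: (harmonic_proportional hp0 hv) (leqnn x) => j jx; apply: phi_rec => //.
exact: leq_trans xy.
Qed.

Lemma W_gt0 (x : nat) : 0 < W C p v x.
Proof. by rewrite W_phi invr_gt0 mulr_gt0// phi_gt0. Qed.

Lemma W_neg (x : int) : x < 0 -> W C p v x = 0.
Proof. by rewrite /W => ->. Qed.

(** By [phi_split], [W] restricted to [0 .. y] is a multiple of [phi y]; taking
    [y = x + 1] transfers the recursion of [phi] at [x]. *)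
Lemma W_harmonic (x : nat) :
  W C p v x = v * conv p (fun n => W C p v n%:Z) x.
Proof.
pose c := p 0%N * phi x.+1 0.
have c0 : c != 0 by rewrite mulf_neq0 ?gt_eqF ?phi_gt0.
have phiE j : (j <= x.+1)%N -> phi x.+1 j = c * W C p v j%:Z.
  move=> jx; rewrite W_phi /c (phi_split jx) mulrA mulrAC mulfV ?mul1r//.
  by rewrite gt_eqF// mulr_gt0// phi_gt0.
apply: (mulfI c0); rewrite -phiE// phi_rec// (eq_conv p phiE).
by rewrite conv_scale mulrCA.
Qed.

Lemma W_increasing (x : nat) : W C p v x < W C p v x.+1.
Proof.
apply: (harmonic_increasing (pmf_ge0 hC) hp0 pmf_sum_le1 hv hnd
  (f := fun n => W C p v n%:Z)) W_harmonic x.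
exact: W_gt0.
Qed.

Definition ruined : pred int := fun z => z <= -1.

Lemma Psi_value x w : Psi C v x w =
  fine (chain_value C climb ruined (fun z => w ^ (- z)) v x).
Proof.
rewrite /Psi /chain_value; congr fine; congr expectation.
by apply/funext => t; rewrite walk_run.
Qed.

Lemma ruined_neg z : z < 0 -> ruined z.
Proof. by rewrite /ruined -ltzD1 addNr. Qed.

Lemma ruined_bounds (w : R) (z : int) : 0 < w <= 1 -> ruined z -> 0 <= w ^ (- z) <= 1.
Proof.
case/andP=> w0 w1; rewrite /ruined => z1.
have /gez0_abs <- : (0 : int) <= - z by rewrite lerNr (le_trans z1).
by rewrite -exprnP exprn_ge0 ?exprn_ile1// ltW.
Qed.

Lemma Psi_neg (x : int) (w : R) : x < 0 -> Psi C v x w = w ^ (- x).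
Proof. by move=> x0; rewrite Psi_value value_stop// ruined_neg. Qed.

Lemma Z_neg (x : int) (w : R) : x < 0 -> Z C p v x w = w ^ (- x).
Proof. by move=> x0; rewrite /Z W_neg// mulr0 addr0 Psi_neg. Qed.

(** [alpha v w * W] has no tail, because [W] vanishes on negative integers. *)
Lemma Z_rec (x : nat) (w : R) : 0 < w <= 1 -> Z C p v x w =
  v * (conv p (fun n => Z C p v n%:Z w) x + tail C (fun j => w ^+ j) x).
Proof.
move=> w01.
rewrite /Z W_harmonic [Psi _ _ _ _]Psi_value.
rewrite (walk_value_rec hC hEC hv (fun z => @ruined_bounds w z w01) ruined_neg)//.
have := conv_linear p 1 (alpha C p v w) (fun n => Psi C v n%:Z w)
  (fun n => W C p v n%:Z) x.
under [X in X = _]eq_conv do rewrite mul1r.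
move=> ->; rewrite mul1r.
rewrite (@eq_tail _ _ _ _ _ _ (fun j => w ^+ j)) => [|j _]; last first.
  by rewrite opprK.
rewrite (@eq_conv _ p _ (fun n => Psi C v n%:Z w)) => [|n _]; last first.
  by rewrite Psi_value.
by rewrite mulrCA !mulrDr addrAC.
Qed.

End scale.

(** * The left derivative of Z at 1 *)

Section left_derivatives.
Set Implicit Arguments.
Unset Strict Implicit.
Context {R : realType} {d : measure_display} {T : measurableType d}.
Context {P : probability T R} {p : nat -> R} {C : nat -> {RV P >-> nat}}.
Hypotheses (hC : iid_with_pmf C p) (hp0 : 0 < p 0%N).
Hypothesis hEC : ('E_P[fun t => (C 0%N t)%:R] < +oo)%E.

Definition slope (f : R -> R) (h : R) : R := h^-1 * (f (1 + h) - f 1).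

(** The difference quotient of [w ^+ j] between [w] and 1, written without
    division so that it also makes sense at [w = 1]. *)
Definition geom (w : R) (j : nat) : R := \sum_(i < j) w ^+ i.

Lemma cvg_geom {I : Type} {F : set_system I} {FF : Filter F} (w : I -> R) j :
  w i @[i --> F] --> (1 : R) -> geom (w i) j @[i --> F] --> (j%:R : R).
Proof.
move=> w1; have -> : j%:R = \sum_(i < j) (1 : R) by rewrite sumr_const card_ord.
apply: cvg_big => [|i _]; first exact: add_continuous.
rewrite -(expr1n R i); elim: (val i) => [|k IHk].
  by under eq_fun do rewrite expr0; exact: cvg_cst.
by under eq_fun do rewrite exprS; rewrite exprS; exact: cvgM.
Qed.

Lemma sublinear_expr (w : R) : 0 <= w <= 1 -> sublinear (fun j => w ^+ j).
Proof.
case/andP=> w0 w1 j j0; rewrite exprn_ge0//=.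
by apply: (@le_trans _ _ 1); rewrite ?exprn_ile1// ler1n.
Qed.

Lemma sublinear_geom (w : R) : 0 <= w <= 1 -> sublinear (geom w).
Proof.
case/andP=> w0 w1 j _; rewrite sumr_ge0/= => [|i _]; last exact: exprn_ge0.
rewrite -[j in j%:R]card_ord -sumr_const; apply: ler_sum => i _.
exact: exprn_ile1.
Qed.

Lemma sublinear_natr : sublinear (fun j => j%:R : R).
Proof. by move=> j _; rewrite ler0n lexx. Qed.

Lemma tail_linear a b g1 g2 x : 0 <= a -> 0 <= b ->
  sublinear g1 -> sublinear g2 -> sublinear (fun j => a * g1 j + b * g2 j) ->
  tail C (fun j => a * g1 j + b * g2 j) x = a * tail C g1 x + b * tail C g2 x.
Proof.
move=> a0 b0 h1 h2 h12; apply: EFin_inj.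
rewrite EFinD !EFinM !(tailE hEC)//.
have J0 (g : nat -> R) t : sublinear g -> (0 <= (jump g x (C 0%N t))%:E)%E.
  by move=> hg; rewrite lee_fin; case/andP: (jump_bounds x (C 0%N t) hg).
have mJ (g : nat -> R) : measurable_fun [set: T] (fun t => (jump g x (C 0%N t))%:E).
  exact: (measurable_claimT (C := C) 0 (fun k => (jump g x k)%:E)).
rewrite -!ge0_integralZl ?lee_fin//; try by move=> t _; exact: J0.
rewrite -ge0_integralD//; last 4 first.
- by move=> t _; rewrite mule_ge0 ?lee_fin// -lee_fin J0.
- exact: measurable_funeM.
- by move=> t _; rewrite mule_ge0 ?lee_fin// -lee_fin J0.
- exact: measurable_funeM.
apply: eq_integral => t _; rewrite -!EFinM -EFinD /jump.
by case: ifP; rewrite ?mulr0 ?addr0.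
Qed.

Lemma slope_tail h x : -1 < h < 0 ->
  slope (fun w => tail C (fun j => w ^+ j) x) h = tail C (geom (1 + h)) x.
Proof.
case/andP=> h1 h0.
have w01 : 0 <= 1 + h <= 1 by rewrite -lerBlDl sub0r ltW//= gerDl ltW.
have geomE j : 1 * (1 + h) ^+ j + - h * geom (1 + h) j = 1 ^+ j.
  have := subrX1 (1 + h) j; rewrite -/(geom _ _) addrAC subrr add0r expr1n.
  by lra.
rewrite /slope; have -> : tail C (fun j => 1 ^+ j) x =
    1 * tail C (fun j => (1 + h) ^+ j) x + (- h) * tail C (geom (1 + h)) x.
  rewrite -tail_linear ?ler01 ?oppr_ge0 ?(ltW h0)//.
  - by apply: eq_tail => j _.
  - exact: sublinear_expr.
  - exact: sublinear_geom.
  - under eq_fun do rewrite geomE.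
    by apply: sublinear_expr; rewrite ler01 lexx.
rewrite mul1r mulNr opprD addrA subrr add0r opprK mulrA mulVf ?mul1r//.
by rewrite lt_eqF.
Qed.

(** Dominated convergence: for [w] in [[0, 1]] the quotient [geom w j] is at most
    [j], so the mean claim dominates. *)
Lemma cvg_tail_geom (w : nat -> R) x : (forall n, 0 <= w n <= 1) ->
  w n @[n --> \oo] --> (1 : R) ->
  tail C (geom (w n)) x @[n --> \oo] --> tail C (fun j => j%:R) x.
Proof.
move=> w01 w1.
have mJ (g : nat -> R) : measurable_fun [set: T] (fun t => (jump g x (C 0%N t))%:E).
  exact: (measurable_claimT (C := C) 0 (fun k => (jump g x k)%:E)).
apply/fine_cvg; rewrite (tailE hEC _ sublinear_natr).
have iC : P.-integrable [set: T] (fun t => ((C 0%N t)%:R : R)%:E).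
  apply/integrableP; split.
    exact: (measurable_claimT (C := C) 0 (fun k => (k%:R)%:E)).
  under eq_integral do rewrite gee0_abs ?lee_fin//.
  by move: hEC; rewrite unlock.
pose f n t := (jump (geom (w n)) x (C 0%N t))%:E.
pose f' t := (jump (fun j => j%:R : R) x (C 0%N t))%:E.
have f_cvg : {ae P, forall t, [set: T] t -> f n t @[n --> \oo] --> f' t}.
  apply: aeW => t _; apply: cvg_EFin; first exact: nearW.
  by rewrite /f' /f /jump; case: ifP => _; [exact: cvg_geom|exact: cvg_cst].
have f_le : {ae P, forall t n, [set: T] t -> (`|f n t| <= (C 0%N t)%:R%:E)%E}.
  apply: aeW => t n _.
  have /andP[j0 jC] := jump_bounds x (C 0%N t) (sublinear_geom (w01 n)).
  by rewrite gee0_abs lee_fin.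
by have [] := dominated_convergence measurableT (fun n => mJ _) (mJ _) f_cvg iC f_le.
Qed.

Lemma near_left0 : \forall h \near (0 : R)^'-, -1 < h < 0.
Proof.
near=> h; apply/andP; split; near: h; last exact: nbhs_left_lt.
by apply: nbhs_left_gt; rewrite ltrN10.
Unshelve. all: by end_near. Qed.

Lemma cvg_left0_add1 : (1 + h : R) @[h --> 0^'-] --> (1 : R).
Proof.
rewrite -[X in _ --> X]addr0; apply: cvgD; first exact: cvg_cst.
by apply: cvg_at_left_filter; exact: cvg_id.
Qed.

Lemma cvg_slope_tail x :
  slope (fun w => tail C (fun j => w ^+ j) x) h @[h --> 0^'-] -->
  tail C (fun j => j%:R) x.
Proof.
(* The truncation at 0 makes the bound by the claim valid for every [h < 0],
   as needed along arbitrary sequences. *)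
apply: (@cvg_trans _ (tail C (geom (Num.max 0 (1 + h))) x @[h --> 0^'-])).
  apply: near_eq_cvg; near=> h.
  have h10 : -1 < h < 0 by near: h; exact: near_left0.
  case/andP: (h10) => h1 h0.
  by rewrite slope_tail// max_r// -lerBlDl sub0r ltW.
apply/cvg_at_leftP => u [u0 u_cvg]; apply: cvg_tail_geom => [n|].
  by rewrite le_max lexx/= ge_max ler01/= gerDl ltW.
apply: (@cvg_trans _ (1 + u n @[n --> \oo])).
  apply: near_eq_cvg; near=> n.
  rewrite max_r// -lerBlDl sub0r ltW//; near: n.
  by apply: (cvgr_gt 0) => //; rewrite ltrN10.
have : 1 + u n @[n --> \oo] --> (1 + 0 : R) by apply: cvgD => //; exact: cvg_cst.
by rewrite addr0.
Unshelve. all: by end_near. Qed.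

Lemma cvg_slope_expr j : slope (fun w => w ^+ j) h @[h --> 0^'-] --> (j%:R : R).
Proof.
apply: (@cvg_trans _ (geom (1 + h) j @[h --> (0 : R)^'-])); last first.
  by apply: cvg_geom; exact: cvg_left0_add1.
apply: near_eq_cvg; near=> h.
have /andP[_ h0] : -1 < h < 0 by near: h; exact: near_left0.
rewrite /slope expr1n subrX1 [1 + h - 1]addrAC subrr add0r mulKf//.
Unshelve. all: by end_near. Qed.

Variable v : R.
Hypothesis hv : 0 < v <= 1.

Lemma Z1_neg (x : int) : x < 0 -> Z1 C p v x = x%:~R.
Proof.
case: x => // n _; rewrite NegzE /Z1 mulrNz; congr (- _).
apply/cvg_lim => //; rewrite (_ : Z C p v (- n.+1%:Z) = fun w => w ^+ n.+1).
  exact: cvg_slope_expr.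
by apply/funext => w; rewrite Z_neg// opprK -exprnP.
Qed.

Lemma slope_Z_rec (x : nat) h : -1 < h < 0 ->
  slope (Z C p v x) h = v * (conv p (fun n => slope (Z C p v n%:Z) h) x +
    slope (fun w => tail C (fun j => w ^+ j) x) h).
Proof.
case/andP=> h1 h0; have w01 : 0 < 1 + h <= 1.
  by rewrite -ltrBlDl sub0r h1/= gerDl ltW.
rewrite (@eq_conv _ p (fun n => slope (Z C p v n%:Z) h) (fun n =>
  h^-1 * Z C p v n%:Z (1 + h) + - h^-1 * Z C p v n%:Z 1)) => [|n _]; last first.
  by rewrite /slope mulrBr mulNr.
rewrite /slope (Z_rec hC hp0 hEC hv _ w01) (Z_rec hC hp0 hEC hv) ?ltr01 ?lexx//.
by rewrite conv_linear; ring.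
Qed.

(** The recursion of [Z] at [x], solved for [Z (x + 1)], expresses the
    difference quotient at [x + 1] through those at [0 .. x], which converge by
    induction, and that of the tail.  At 0 the function [Z] is constant. *)
Lemma cvg_slope_Z (x : nat) : slope (Z C p v x) h @[h --> 0^'-] --> - Z1 C p v x.
Proof.
have Z1E (n : nat) (l : R) : slope (Z C p v n) h @[h --> 0^'-] --> l ->
    slope (Z C p v n) h @[h --> 0^'-] --> - Z1 C p v n.
  by rewrite /Z1 opprK => nl; rewrite [left_derivative _ _](cvg_lim _ nl).
elim/ltn_ind: x => -[|x] IHx.
  apply: (Z1E 0%N 0); rewrite (_ : slope _ = cst 0); first exact: cvg_cst.
  by apply/funext => h; rewrite /slope !Z_at0// subrr mulr0.
pose S (h : R) := \sum_(k < x.+1) p k.+1 * slope (Z C p v (x - k)%N) h.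
pose t := slope (fun w => tail C (fun j => w ^+ j) x).
apply: (Z1E _ ((v * p 0%N)^-1 * (- Z1 C p v x - v *
  (\sum_(k < x.+1) p k.+1 * - Z1 C p v (x - k)%N + tail C (fun j => j%:R) x)))).
apply: (@cvg_trans _ ((v * p 0%N)^-1 * (slope (Z C p v x) h - v *
    (S h + t h)) @[h --> 0^'-])).
  apply: near_eq_cvg; near=> h.
  have h10 : -1 < h < 0 by near: h; exact: near_left0.
  rewrite slope_Z_rec// conv_recl -/(t _) -/(S h).
  by field; rewrite !gt_eqF//; case/andP: hv.
apply: cvgMl_tmp; apply: cvgB; first exact: IHx.
apply: cvgMl_tmp; apply: cvgD; last exact: cvg_slope_tail.
apply: cvg_big => [|k _]; first exact: add_continuous.
by apply: cvgMl_tmp; apply: IHx; rewrite ltnS leq_subr.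
Unshelve. all: by end_near. Qed.

Lemma Z1_rec (x : nat) : Z1 C p v x =
  v * (conv p (fun n => Z1 C p v n%:Z) x - tail C (fun j => j%:R) x).
Proof.
apply: oppr_inj; rewrite -(cvg_lim _ (@cvg_slope_Z x))//; apply/cvg_lim => //.
apply: (@cvg_trans _ (v * (conv p (fun n => slope (Z C p v n%:Z) h) x +
    slope (fun w => tail C (fun j => w ^+ j) x) h) @[h --> 0^'-])).
  apply: near_eq_cvg; near=> h.
  by rewrite slope_Z_rec//; near: h; exact: near_left0.
rewrite -mulrN opprB [_ - conv _ _ _]addrC /conv -sumrN.
apply: cvgMl_tmp; apply: cvgD; last exact: cvg_slope_tail.
apply: cvg_big => [|k _]; first exact: add_continuous.
by rewrite -mulrN; apply: cvgMl_tmp; exact: cvg_slope_Z.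
Unshelve. all: by end_near. Qed.

End left_derivatives.

(** * The process reflected at b *)

Section dividends.
Set Implicit Arguments.
Unset Strict Implicit.
Context {R : realType} {d : measure_display} {T : measurableType d}.
Context {P : probability T R} {p : nat -> R} {C : nat -> {RV P >-> nat}}.
Hypotheses (hC : iid_with_pmf C p) (hp0 : 0 < p 0%N).
Hypothesis hEC : ('E_P[fun t => (C 0%N t)%:R] < +oo)%E.
Variables (v : R) (b : nat).
Hypothesis hv : 0 < v <= 1.
Hypothesis hnd : ~ (p 0%N + p 1%N = 1 /\ v = 1).

Let v0 : 0 <= v. Proof. by case/andP: hv => /ltW. Qed.

Definition reflect_at (z : int) (k : nat) : int :=
  if z < 0 then z else z + 1 - k%:Z - dividend b (z + 1 - k%:Z).

Definition insolvent : pred int := fun z => z < 0.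
Definition deficit (z : int) : R := (- z)%:~R.
Local Notation ruin_cost := (chain_value C reflect_at insolvent deficit v).
Local Notation natr := (fun j => j%:R : R).

Lemma sub_dividend z : z - dividend b z = Num.min z b%:Z.
Proof. by rewrite /dividend; clear -b z; lia. Qed.

Lemma deficit_ge0 z : insolvent z -> 0 <= deficit z.
Proof. by rewrite /insolvent /deficit ler0z oppr_ge0 => /ltW. Qed.

(** The initial dividend brings the surplus down to [min x b]; above [b] the
    value therefore does not depend on the initial capital. *)
Lemma VB_ruin_cost x : VB C b v x = ruin_cost (Num.min x b%:Z).
Proof.
rewrite /VB /chain_value; congr expectation; apply/funext => t.
suff -> : reflected (C ^~ t) b x =
    run reflect_at (C ^~ t) (Num.min x b%:Z) by [].
apply/funext; elim=> [|n /= ->]; last by [].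
exact: sub_dividend.
Qed.

Lemma reflected_series (F : int -> \bar R) (h : nat -> R) (x : nat) :
  (forall n, (n <= b)%N -> 0 <= h n) ->
  (forall z, z < 0 -> F z = (deficit z)%:E) ->
  (forall n : nat, (n <= b)%N -> F n%:Z = (h n)%:E) ->
  (\sum_(k <oo) (p k)%:E * F (reflect_at x k))%E =
  (conv p (fun n => h (minn n b)) x + tail C natr x)%:E.
Proof.
move=> h0 Fneg Fh.
apply: (series_split hC hEC) => [n||k kx|k kx].
- by rewrite h0// geq_minr.
- exact: sublinear_natr.
- rewrite /reflect_at ltNge lez_nat leq0n/= sub_dividend.
  have -> : Num.min (x%:Z + 1 - k%:Z) b%:Z = (minn (x.+1 - k) b)%:Z by lia.
  by rewrite Fh// geq_minr.
- rewrite /reflect_at ltNge lez_nat leq0n/= sub_dividend.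
  have -> : Num.min (x%:Z + 1 - k%:Z) b%:Z = - (k - x.+1)%:Z by lia.
  by rewrite Fneg ?/deficit ?opprK//; lia.
Qed.

Let slope_ratio := fdiff (Z1 C p v) b / fdiff (W C p v) b.
Let candidate (n : nat) : R := W C p v n * slope_ratio - Z1 C p v n.

Lemma candidate_rec x :
  candidate x = v * (conv p candidate x + tail C natr x).
Proof.
rewrite /candidate {1}(W_harmonic hC hp0 hEC hv) (Z1_rec hC hp0 hEC hv).
rewrite (@eq_conv _ p (fun n => _ - _) (fun n =>
  slope_ratio * W C p v n%:Z + -1 * Z1 C p v n%:Z)) => [|n _]; last first.
  by rewrite mulN1r mulrC.
by rewrite conv_linear; ring.
Qed.

(** [slope_ratio] is the factor of [W] for which this equality holds. *)
Lemma candidate_boundary : candidate b.+1 = candidate b.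
Proof.
have dW : fdiff (W C p v) b != 0.
  by rewrite /fdiff gt_eqF// subr_gt0 (W_increasing hC hp0 hEC hv hnd).
have : fdiff (W C p v) b * slope_ratio = fdiff (Z1 C p v) b.
  by rewrite mulrCA mulfV// mulr1.
by rewrite /candidate /fdiff; lra.
Qed.

(** Among the arguments at most [x + 1], only [b + 1] is affected by the
    reflection, and there the boundary condition applies. *)
Lemma candidate_reflected x : (x <= b)%N -> candidate x =
  v * (conv p (fun n => candidate (minn n b)) x + tail C natr x).
Proof.
move=> xb; rewrite candidate_rec.
rewrite (@eq_conv _ p candidate (fun n => candidate (minn n b)))// => n nx.
have [//|bn] := leqP n b.
by rewrite -candidate_boundary; congr candidate; lia.
Qed.

Let min_principle := minimum_principle (pmf_ge0 hC) hp0 (pmf_sum_le1 hC) hv hnd.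

Lemma candidate_ge0 n : (n <= b)%N -> 0 <= candidate n.
Proof.
apply: min_principle n => x xb; rewrite [leRHS]candidate_reflected// mulrDr.
by rewrite lerDl mulr_ge0// (tail_ge0 _ _ sublinear_natr).
Qed.

(** Finiteness of the expected deficit under reflection: the candidate, extended
    by the deficit below 0, is a nonnegative superharmonic majorant. *)
Lemma ruin_cost_bounds (n : nat) : (n <= b)%N ->
  (0 <= ruin_cost n <= (candidate n)%:E)%E.
Proof.
move=> nb; rewrite (value_ge0 hC)//=; last exact: deficit_ge0.
pose H z : \bar R := (if z < 0 then deficit z else candidate (minn `|z| b))%:E.
have Hnat (m : nat) : (m <= b)%N -> H m%:Z = (candidate m)%:E.
  by move=> mb; rewrite /H ltNge lez_nat leq0n/= (minn_idPl mb).
rewrite -Hnat//.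
apply: (@value_le _ _ _ _ _ _ hC reflect_at insolvent deficit v v0 deficit_ge0
  (fun z => z <= b%:Z) H) => //.
- move=> z k _; rewrite /insolvent /reflect_at => /negbTE ->.
  by rewrite sub_dividend ge_min lexx orbT.
- move=> z; rewrite /H lee_fin; case: ifP => [|_]; first exact: deficit_ge0.
  by rewrite candidate_ge0// geq_minr.
- by move=> z _; rewrite /insolvent /H => ->.
- case=> [m|m] // mb _; rewrite (reflected_series (h := candidate))//.
  + by rewrite Hnat// -EFinM lee_fin -candidate_reflected.
  + exact: candidate_ge0.
  + by move=> z z0; rewrite /H z0.
Qed.

Lemma ruin_cost_fin (n : nat) : (n <= b)%N ->
  ruin_cost n = (fine (ruin_cost n))%:E.
Proof.
move=> /ruin_cost_bounds/andP[c0 c_le]; rewrite fineK// ge0_fin_numE//.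
by apply: le_lt_trans c_le _; exact: ltry.
Qed.

Lemma ruin_cost_reflected (x : nat) : (x <= b)%N -> fine (ruin_cost x) =
  v * (conv p (fun n => fine (ruin_cost (minn n b))) x + tail C natr x).
Proof.
move=> xb; apply: EFin_inj; rewrite -ruin_cost_fin//.
rewrite (value_first_step hC)//; last exact: deficit_ge0.
rewrite (reflected_series (h := fun n => fine (ruin_cost n%:Z)))//.
- by move=> n /ruin_cost_bounds/andP[+ _]; exact: fine_ge0.
- by move=> z z0; rewrite value_stop.
- by move=> n; exact: ruin_cost_fin.
Qed.

(** The difference of two solutions solves the recursion without tail, so the
    minimum principle applies to it with either sign. *)
Lemma ruin_cost_candidate (n : nat) : (n <= b)%N ->
  ruin_cost n = (candidate n)%:E.
Proof.
move=> nb; rewrite ruin_cost_fin//; congr EFin.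
pose gap s n := s * candidate n + - s * fine (ruin_cost n).
have gap_ge0 s : 0 <= gap s n.
  apply: min_principle nb => x xb; rewrite conv_linear /gap.
  by rewrite ruin_cost_reflected// candidate_reflected//; lra.
apply/eqP; rewrite eq_le.
by have := (gap_ge0 1, gap_ge0 (-1)) => -[]; rewrite /gap; lra.
Qed.

Lemma VB_formula (x : int) : x <= b%:Z ->
  VB C b v x = (W C p v x * slope_ratio - Z1 C p v x)%:E.
Proof.
move=> xb; rewrite VB_ruin_cost min_l//; case: x xb => [n|n] nb.
  exact: ruin_cost_candidate.
by rewrite value_stop// Z1_neg// W_neg// mul0r sub0r /deficit mulrNz.
Qed.

End dividends.

Theorem proposition42 (R : realType) (d : measure_display)
    (T : measurableType d) (P : probability T R) (p : nat -> R)
    (C : nat -> {RV P >-> nat}) (b : nat) (v : R)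
    (hp : is_pmf p) (hp0 : 0 < p 0%N) (hC : iid_with_pmf C p)
    (hEC : ('E_P[fun t => (C 0%N t)%:R] < +oo)%E)
    (hv : 0 < v <= 1)
    (hnd : ~ (p 0%N + p 1%N = 1 /\ v = 1))
    (x : int) :
  VB C b v x =
    (if x <= b%:Z then
       (W C p v x * (fdiff (Z1 C p v) b / fdiff (W C p v) b) - Z1 C p v x)%:E
     else VB C b v b%:Z).
Proof.
case: ifPn => [xb|]; first exact: VB_formula.
by rewrite -ltNge => bx; rewrite !VB_ruin_cost min_r ?ltW// minxx.
Qed.
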